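(* For every triple $(M,\pi_0,\mathcal L)$ comprising (1) a deterministic MDP $M=(S,A,T,R,\gamma)$ with $|S|=2$ and $|A|=k\ge 2$, (2) a policy $\pi_0:S\to A$ for $M$, and (3) a policy iteration (PI) algorithm $\mathcal L$ that performs max-gain action selection, the number of policies evaluated by $\mathcal L$ if initialised at $\pi_0$ and executed on $M$ is at most $7$.
   Context: A (finite, discounted) MDP is a tuple $(S,A,T,R,\gamma)$ with finite state set $S$; finite action set $A$ (all actions available at every state); transition function $T:S\times A\times S\to[0,1]$ with $\sum_{s'}T(s,a,s')=1$; reward function $R:S\times A\to\mathbb R$; and discount factor $\gamma\in[0,1)$. It is deterministic (a DMDP) if $T$ takes values in $\{0,1\}$. A policy is a map $\pi:S\to A$. Its value function $V^\pi:S\to\mathbb R$ is the unique solution of $V^\pi(s)=R(s,\pi(s))+\gamma\sum_{s'}T(s,\pi(s),s')V^\pi(s')$. The action value function is $Q^\pi(s,a)=R(s,a)+\gamma\sum_{s'}T(s,a,s')V^\pi(s')$ and the gain is $\rho^\pi(s,a)=Q^\pi(s,a)-V^\pi(s)$. The improvable set is $I^\pi=\{(s,a):\rho^\pi(s,a)>0\}$. A valid improvement set is a nonempty $I\subseteq I^\pi$ containing at most one pair $(s,a)$ for each $s\in S$. A policy improvement step from $\pi$ using $I$ yields the policy $\pi'$ with $\pi'(s)=a$ if $(s,a)\in I$ and $\pi'(s)=\pi(s)$ otherwise. The step uses max-gain action selection if for each $(s,a)\in I$, the action $a$ maximises $\rho^\pi(s,\cdot)$ over all actions (ties broken arbitrarily);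 the set of states at which switches are made is unrestricted. A PI algorithm with max-gain action selection, started at a policy $\pi_0$, produces a sequence $\pi_0,\pi_1,\dots,\pi_\ell$, each $\pi_{i+1}$ being obtained from $\pi_i$ by a policy improvement step with max-gain action selection, and stops when $I^{\pi_\ell}=\emptyset$. The policies evaluated are $\pi_0,\dots,\pi_\ell$, so their number is $\ell+1$. *)

(* Defs.v *)
From mathcomp Require Import all_boot all_order all_algebra.
From mathcomp Require Import reals.

Set Implicit Arguments.
Unset Strict Implicit.
Unset Printing Implicit Defensive.

Import Order.TTheory GRing.Theory Num.Theory.
Local Open Scope ring_scope.

Record mdp (R : realType) (S A : finType) := MDP {
  trans : S -> A -> S -> R;
  reward : S -> A -> R;
  discount : R;
  trans_itv : forall s a s', 0 <= trans s a s' <= 1;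
  trans_sum1 : forall s a, \sum_s' trans s a s' = 1;
  discount_itv : 0 <= discount < 1 }.

Definition deterministic (R : realType) (S A : finType) (M : mdp R S A) : Prop :=
  forall s a s', trans M s a s' = 0 \/ trans M s a s' = 1.

Definition policy (S A : finType) := {ffun S -> A}.

Definition bellman (R : realType) (S A : finType) (M : mdp R S A)
    (pi : policy S A) (V : {ffun S -> R}) : bool :=
  [forall s, V s ==
    reward M s (pi s) + discount M * \sum_s' trans M s (pi s) s' * V s'].

Lemma bellman_homog (R : realType) (S A : finType) (M : mdp R S A)
    (pi : policy S A) (D : S -> R) :
  (forall s, D s = discount M * \sum_s' trans M s (pi s) s' * D s') ->
  forall s, D s = 0.
Proof.
move=> HD s; have /andP[g0 g1] := discount_itv M.
case: (@Order.TotalTheory.arg_maxP _ _ _ s xpredT (fun t => `|D t|) isT).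
move=> t _ Ht.
have Dt : `|D t| <= discount M * `|D t|.
  rewrite {1}HD normrM ger0_norm //; apply: ler_wpM2l => //.
  apply: le_trans (ler_norm_sum _ _ _) _.
  rewrite -[leRHS]mul1r -(trans_sum1 M t (pi t)) mulr_suml.
  apply: ler_sum => s' _; have /andP[T0 _] := trans_itv M t (pi t) s'.
  by rewrite normrM ger0_norm //; apply: ler_wpM2l => //; exact: Ht.
have Dt0 : `|D t| <= 0.
  by rewrite -(pmulr_rle0 _ (_ : 0 < 1 - discount M)) ?subr_gt0 // mulrBl mul1r subr_le0.
by apply/eqP; rewrite -normr_le0; apply: le_trans Dt0; exact: Ht.
Qed.

Lemma bellman_unique (R : realType) (S A : finType) (M : mdp R S A)
    (pi : policy S A) (V W : {ffun S -> R}) :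
  bellman M pi V -> bellman M pi W -> V = W.
Proof.
move=> /forallP HV /forallP HW; apply/ffunP => s; apply/eqP.
rewrite -subr_eq0; apply/eqP; move: s.
apply: (@bellman_homog _ _ _ M pi) => s.
rewrite (eqP (HV s)) (eqP (HW s)) opprD addrACA subrr add0r -mulrBr -sumrB.
by congr (_ * _); apply: eq_bigr => s' _; rewrite mulrBr.
Qed.

Lemma bellman_exists (R : realType) (S A : finType) (M : mdp R S A)
    (pi : policy S A) : exists V, bellman M pi V.
Proof.
pose P := \matrix_(i < #|S|, j < #|S|)
  trans M (enum_val i) (pi (enum_val i)) (enum_val j).
pose B := 1%:M - discount M *: P.
have BE (v : 'cV[R]_#|S|) s : (B *m v) (enum_rank s) 0 = v (enum_rank s) 0 -
    discount M * \sum_s' trans M s (pi s) s' * v (enum_rank s') 0.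
  rewrite mulmxBl mul1mx -scalemxAl [LHS]mxE; congr (_ + _).
  rewrite [LHS]mxE; congr (- _); rewrite [LHS]mxE; congr (_ * _).
  rewrite mxE (reindex (@enum_rank S)) /=; last exact/onW_bij/enum_rank_bij.
  by apply: eq_bigr => s' _; rewrite mxE !enum_rankK.
have uB : B \in unitmx.
  rewrite unitmxE unitfE -det_tr; apply/det0P => -[v v0 vB].
  have Bv : B *m v^T = 0 by rewrite -[B]trmxK -trmx_mul vB trmx0.
  case/eqP: v0; apply/rowP => j; rewrite [RHS]mxE.
  have := @bellman_homog _ _ _ M pi (fun s => v^T (enum_rank s) 0).
  move=> /(_ _ (enum_val j)); rewrite enum_valK mxE; apply=> s.
  by apply/eqP; rewrite -subr_eq0 -BE Bv mxE.
pose r : 'cV[R]_#|S| := \col_i reward M (enum_val i) (pi (enum_val i)).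
exists [ffun s => (invmx B *m r) (enum_rank s) 0]; apply/forallP => s.
rewrite ffunE -subr_eq.
under eq_bigr do rewrite ffunE.
by rewrite -BE mulKVmx // mxE enum_rankK.
Qed.

Definition value (R : realType) (S A : finType) (M : mdp R S A)
    (pi : policy S A) : {ffun S -> R} :=
  xchoose (bellman_exists M pi).

Definition action_value (R : realType) (S A : finType) (M : mdp R S A)
    (pi : policy S A) (s : S) (a : A) : R :=
  reward M s a + discount M * \sum_s' trans M s a s' * value M pi s'.

Definition gain (R : realType) (S A : finType) (M : mdp R S A)
    (pi : policy S A) (s : S) (a : A) : R :=
  action_value M pi s a - value M pi s.

Definition improvable (R : realType) (S A : finType) (M : mdp R S A)
    (pi : policy S A) : {set S * A} :=
  [set p | 0 < gain M pi p.1 p.2].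

Definition valid_improvement (R : realType) (S A : finType) (M : mdp R S A)
    (pi : policy S A) (I : {set S * A}) : Prop :=
  [/\ I != set0, I \subset improvable M pi &
      forall s a b, (s, a) \in I -> (s, b) \in I -> a = b].

(* For valid I, the pick returns the unique a with (s, a) \in I, if any. *)
Definition improve (S A : finType) (pi : policy S A) (I : {set S * A}) :
    policy S A :=
  [ffun s => odflt (pi s) [pick a | (s, a) \in I]].

Definition max_gain (R : realType) (S A : finType) (M : mdp R S A)
    (pi : policy S A) (I : {set S * A}) : Prop :=
  forall s a, (s, a) \in I -> forall b, gain M pi s b <= gain M pi s a.

(* [choices L M h] is the set of improvement sets that L may use on M after
   having evaluated the policies in h, in this order (the current policy is
   the last one).  It may depend on the whole history, and having several
   elements accounts for nondeterministic or randomised algorithms.  It is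
   empty, so that L stops, exactly when the current policy is not improvable. *)
Record pi_algorithm (R : realType) (S A : finType) := PIAlgorithm {
  choices : mdp R S A -> seq (policy S A) -> {set {set S * A}};
  choices_neq0 : forall M h pi,
    improvable M pi != set0 -> choices M (rcons h pi) != set0;
  choices_valid : forall M h pi I,
    I \in choices M (rcons h pi) -> valid_improvement M pi I }.

Definition max_gain_selection (R : realType) (S A : finType)
    (L : pi_algorithm R S A) : Prop :=
  forall M h pi I, I \in choices L M (rcons h pi) -> max_gain M pi I.

(* The possible sequences of policies evaluated so far at some point of an
   execution of L.  Every prefix of an execution is included, so a bound on
   the length of all these sequences also entails termination. *)
Inductive evaluated (R : realType) (S A : finType) (L : pi_algorithm R S A)
    (M : mdp R S A) (pi0 : policy S A) : seq (policy S A) -> Prop :=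
| evaluated_init : evaluated L M pi0 [:: pi0]
| evaluated_step h pi I :
    evaluated L M pi0 (rcons h pi) -> I \in choices L M (rcons h pi) ->
    evaluated L M pi0 (rcons (rcons h pi) (improve pi I)).

(* Main.v *)
Require Import Defs.
From mathcomp Require Import all_boot all_order all_algebra.
From mathcomp Require Import reals.

(* With two states and deterministic transitions, an action at s is a loop or a
   crossing, and a max-gain switch always lands on an action of maximal reward
   in its class.  Hence after a switch the action at s is, up to its effect on
   values, one of two; together with a possibly suboptimal initial action this
   gives three codes per state, hence nine codes of policies.  Values strictly
   increase along the run, so no code repeats; and the suboptimal initial action
   of a state never comes back, so the two codes in which only the first state
   has left it cannot coexist with the two in which only the second one has:
   at most 9 - 2 = 7 codes occur. *)

Set Implicit Arguments.
Unset Strict Implicit.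
Unset Printing Implicit Defensive.

Import Order.TTheory GRing.Theory Num.Theory.

Section Mdp.
Local Open Scope ring_scope.
Variables (R : realType) (S A : finType) (M : mdp R S A).
Implicit Types (pi : policy S A) (I : {set S * A}) (s : S) (a b : A).

Lemma valueE pi s : value M pi s =
  reward M s (pi s) + discount M * \sum_s' trans M s (pi s) s' * value M pi s'.
Proof. by have /forallP/(_ s)/eqP := xchooseP (bellman_exists M pi). Qed.

Lemma gain_policy pi s : gain M pi s (pi s) = 0.
Proof. by rewrite /gain /action_value -valueE subrr. Qed.

Lemma improve_in pi I s a :
  valid_improvement M pi I -> (s, a) \in I -> improve pi I s = a.
Proof.
case=> _ _ uniqI Isa; rewrite ffunE; case: pickP => [b Isb|/(_ a)] /=.
  exact: uniqI Isb Isa.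
by rewrite Isa.
Qed.

Lemma improveP pi I s :
  (s, improve pi I s) \in I \/ improve pi I s = pi s.
Proof. by rewrite ffunE; case: pickP => [a Isa|_]; [left|right]. Qed.

Lemma gain_improve_ge0 pi I s :
  valid_improvement M pi I -> 0 <= gain M pi s (improve pi I s).
Proof.
case=> _ /subsetP sI _; have [Is|->] := improveP pi I s.
  by have := sI _ Is; rewrite inE => /ltW.
by rewrite gain_policy.
Qed.

(** The increment of the value solves the Bellman equation of [pi'] with the gain over [pi] as
    reward. Monotonicity and strictness of improvement both follow from this. *)
Lemma value_diff pi pi' s : value M pi' s - value M pi s =
  gain M pi s (pi' s) + discount M *
    \sum_s' trans M s (pi' s) s' * (value M pi' s' - value M pi s').
Proof.
under eq_bigr do rewrite mulrBr.
by rewrite sumrB mulrBr [in LHS]valueE /gain /action_value [RHS]addrAC -[in RHS](addrA (reward _ _ _)) subrKC.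
Qed.

(** Minimum principle: where the increment [D] is least, its average over successors is no smaller,
    so [discount M * D t <= D t], and a discount below 1 forces [0 <= D t]. *)
Lemma value_monotone pi pi' :
  (forall s, 0 <= gain M pi s (pi' s)) ->
  forall s, value M pi s <= value M pi' s.
Proof.
move=> gain_ge0 s; pose D s := value M pi' s - value M pi s.
case: (@Order.TotalTheory.arg_minP _ _ _ s xpredT D isT) => t _ minD.
have /andP[disc_ge0 disc_lt1] := discount_itv M.
suff Dt_ge0 : 0 <= D t by rewrite -subr_ge0; apply: le_trans (minD s isT).
have Dt_ge : discount M * D t <= D t.
  rewrite {2}/D value_diff -[leLHS]add0r lerD ?gain_ge0 ?ler_wpM2l //.
  rewrite -[leLHS]mul1r -(trans_sum1 M t (pi' t)) mulr_suml.
  apply: ler_sum => s' _; apply: ler_wpM2l; last exact: minD.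
  by have /andP[] := trans_itv M t (pi' t) s'.
by rewrite -(pmulr_rge0 _ (_ : 0 < 1 - discount M)) ?subr_gt0 // mulrBl mul1r subr_ge0.
Qed.

Lemma value_improve_neq pi I :
  valid_improvement M pi I -> value M pi != value M (improve pi I).
Proof.
move=> validI; have [/set0Pn[[s a] Isa] /subsetP sI _] := validI.
apply/eqP => eqV; have := sI _ Isa; rewrite inE /=.
have := value_diff pi (improve pi I) s.
rewrite -eqV subrr big1 => [|s' _]; last by rewrite subrr mulr0.
by rewrite mulr0 addr0 (improve_in validI Isa) => <-; rewrite ltxx.
Qed.

(** A class consists of the actions at [s] with the same transition row; ties in reward are
    allowed. *)
Definition best_in_class s a : bool :=
  [forall b, [forall s', trans M s b s' == trans M s a s'] ==>
    (reward M s b <= reward M s a)].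

(** Inside a class, gains differ only through the immediate reward. *)
Lemma max_gain_best pi I s a :
  max_gain M pi I -> (s, a) \in I -> best_in_class s a.
Proof.
move=> maxI Isa; apply/forallP => b; apply/implyP => /forallP eqT.
have := maxI _ _ Isa b; rewrite /gain /action_value lerD2r.
by under eq_bigr do rewrite (eqP (eqT _)); rewrite lerD2r.
Qed.

(** [Some true] is a best loop and [Some false] a best crossing. [None] lumps all other actions
    together, which loses nothing along a run: only the initial action can have this code. *)
Definition action_code s a : option bool :=
  if best_in_class s a then Some (trans M s a s == 1) else None.

Lemma eq_value pi pi' :
  (forall s s', trans M s (pi s) s' = trans M s (pi' s) s') ->
  (forall s, reward M s (pi s) = reward M s (pi' s)) ->
  value M pi = value M pi'.
Proof.
move=> eqT eqR; apply: (@bellman_unique _ _ _ M pi).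
  exact: xchooseP (bellman_exists M pi).
apply/forallP => s; rewrite eqR [in eqbLHS]valueE.
by under [in eqbRHS]eq_bigr do rewrite eqT.
Qed.

Hypotheses (card_S : #|S| = 2%N) (det_M : deterministic M).

Lemma trans_two_states s a b s' :
  (trans M s a s == 1) = (trans M s b s == 1) -> trans M s a s' = trans M s b s'.
Proof.
move=> eq1; have eqs : trans M s a s = trans M s b s.
  by case: (det_M s a s) (det_M s b s) eq1 => -> [] ->;
    rewrite ?eqxx // ?[0 == _]eq_sym oner_eq0.
have [->//|s's] := eqVneq s' s.
have sumT c : trans M s c s + trans M s c s' = 1.
  rewrite -(trans_sum1 M s c) (bigD1 s) //= (bigD1 s') //= big1 ?addr0 // => t.
  case/andP=> ts ts'; suff : (2 < #|S|)%N by rewrite card_S.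
  have <- : #|[set s; s'; t]| = 3%N.
    rewrite -setUA cardsU1 cards2 !inE negb_or.
    by rewrite [s == _]eq_sym s's [s == _]eq_sym ts eq_sym ts'.
  exact: max_card.
by apply: (addrI (trans M s a s)); rewrite sumT eqs sumT.
Qed.

(** A common code [Some _] puts both actions in one class, where each is best, so their rewards
    agree; a common code [None] forces both to be the action of [pi0]. *)
Lemma code_value pi0 pi pi' :
  (forall s, best_in_class s (pi s) \/ pi s = pi0 s) ->
  (forall s, best_in_class s (pi' s) \/ pi' s = pi0 s) ->
  (forall s, action_code s (pi s) = action_code s (pi' s)) ->
  value M pi = value M pi'.
Proof.
move=> Hpi Hpi' eqc.
have eqTR s : (forall s', trans M s (pi s) s' = trans M s (pi' s) s') /\
    reward M s (pi s) = reward M s (pi' s).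
  move: (eqc s) (Hpi s) (Hpi' s); rewrite /action_code.
  case: ifP => [bpi|_]; case: ifP => [bpi'|_] //.
    case=> /trans_two_states eqT _ _; split=> [s'|]; first exact: eqT.
    apply/le_anti/andP; split.
      move/forallP/(_ (pi s))/implyP: bpi'; apply.
      by apply/forallP => s'; rewrite eqT.
    move/forallP/(_ (pi' s))/implyP: bpi; apply.
    by apply/forallP => s'; rewrite eqT.
  by move=> _ [//|->] [//|->].
by apply: eq_value => s; case: (eqTR s).
Qed.

(** Monotonicity is included because inequality of values alone is not transitive; with it, a
    property of consecutive policies extends to all pairs of a run. *)
Definition improves pi pi' : bool :=
  [&& [forall s, value M pi s <= value M pi' s], value M pi != value M pi' &
    [forall s, best_in_class s (pi s) ==> best_in_class s (pi' s)]].

Lemma improves_trans : transitive improves.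
Proof.
move=> pi2 pi1 pi3 /and3P[/forallP le12 ne12 /forallP b12].
case/and3P=> [/forallP le23 ne23 /forallP b23]; apply/and3P; split.
- by apply/forallP => s; apply: le_trans (le23 s).
- apply: contraNneq ne12 => eq13; apply/eqP/ffunP => s.
  by apply/le_anti; rewrite le12 eq13 le23.
- by apply/forallP => s; apply/implyP => /(implyP (b12 s))/(implyP (b23 s)).
Qed.

Lemma improves_improve pi I :
  valid_improvement M pi I -> max_gain M pi I -> improves pi (improve pi I).
Proof.
move=> validI maxI; apply/and3P; split; last 1 first.
- apply/forallP => s; apply/implyP.
  by case: (improveP pi I s) => [/(max_gain_best maxI)|->].
- apply/forallP/value_monotone => s; exact: gain_improve_ge0.
- exact: value_improve_neq.
Qed.

Lemma evaluated_invariant (L : pi_algorithm R S A) pi0 pis :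
  max_gain_selection L -> evaluated L M pi0 pis ->
  pairwise improves pis /\
  {in pis, forall pi s, best_in_class s (pi s) \/ pi s = pi0 s}.
Proof.
move=> maxL; rewrite -(sorted_pairwise improves_trans).
elim=> [|h pi I _ [sorted_h best_h] LI].
  by split=> // pi; rewrite inE => /eqP-> s; right.
have maxI := maxL _ _ _ _ LI; have validI := choices_valid LI.
split.
  case: h sorted_h {best_h LI} => [|p h] /= sorted_h.
    by rewrite improves_improve.
  by rewrite rcons_path sorted_h last_rcons improves_improve.
move=> pi'; rewrite mem_rcons inE => /predU1P[->|/best_h//] s.
case: (improveP pi I s) => [/(max_gain_best maxI)|->]; first by left.
by apply: best_h; rewrite mem_rcons mem_head.
Qed.

End Mdp.

(** Read as a boolean, a code is true when it is not [None]. Either some [(None, Some _)] occurs,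
    which rules out both [(Some _, None)], or none does; two of the nine pairs are missing either
    way. *)
Lemma size_code_pairs (cs : seq (option bool * option bool)) :
  uniq cs ->
  {in cs &, forall c d : option bool * option bool, ~ [/\ ~~ c.1, c.2, d.1 & ~~ d.2]} ->
  size cs <= 7.
Proof.
move=> uniq_cs excl.
have bound u : {subset cs <= filter (predC u) (enum {: option bool * option bool})} ->
    count (predC u) (enum {: option bool * option bool}) <= 7 -> size cs <= 7.
  by move=> sub; apply: leq_trans; rewrite -size_filter; apply: uniq_leq_size.
have enumE : perm_eq (enum {: option bool * option bool})
    [seq (x, y) | x <- [:: None; Some true; Some false],
                  y <- [:: None; Some true; Some false]].
  apply: uniq_perm; rewrite ?enum_uniq // => c; rewrite mem_enum.
  by case: c => [[[]|] [[]|]].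
have [/hasP[c csc /andP[c1 c2]]|/hasPn no_c] :=
  boolP (has (fun c : option bool * option bool => ~~ c.1 && c.2) cs).
- apply: (bound (fun d => d.1 && ~~ d.2)); last by rewrite (permP enumE).
  move=> d csd; rewrite mem_filter mem_enum andbT /=.
  by apply/negP => /andP[d1 d2]; apply: (excl c d csc csd).
- apply: (bound (fun d => ~~ d.1 && d.2)); last by rewrite (permP enumE).
  by move=> d csd; rewrite mem_filter mem_enum andbT /= no_c.
Qed.

Theorem proposition5 (R : realType) (S A : finType) (k : nat)
    (hS : #|S| = 2) (hA : #|A| = k) (hk : 2 <= k)
    (M : mdp R S A) (hM : deterministic M) (pi0 : policy S A)
    (L : pi_algorithm R S A) (hL : max_gain_selection L)
    (pis : seq (policy S A)) (hpis : evaluated L M pi0 pis) :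
  size pis <= 7.
Proof.
have [pw best] := evaluated_invariant hL hpis.
have [x [y Sxy]] : exists x y : S, forall s, s = x \/ s = y.
  have /eqP/cards2P[x [y [_ Sxy]]] : #|[set: S]| = 2 by rewrite cardsT.
  exists x, y => s.
  by have := in_setT s; rewrite Sxy !inE => /orP[]/eqP; [left|right].
pose code (pi : policy S A) := (action_code M x (pi x), action_code M y (pi y)).
rewrite -(size_map code); apply: size_code_pairs.
  rewrite uniq_pairwise pairwise_map; move: pw; apply: sub_in_pairwise (allss _).
  move=> p q /best bp /best bq /and3P[_ neV _] /=; apply: contraNneq neV => -[cx cy].
  by apply/eqP/(code_value hS hM bp bq) => s; case: (Sxy s) => ->.
have codeE s a : action_code M s a = best_in_class M s a :> bool.
  by rewrite /action_code; case: ifP.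
move=> _ _ /mapP[p pp ->] /mapP[q qq ->]; rewrite /code /= !codeE => -[px py qx qy].
(* Whichever of [p] and [q] comes first, the state where it is already best must stay best in the
   other, which fails at [y] or at [x]. *)
have total : [|| p == q, improves M p q | improves M q p].
  move: pw; rewrite -(sorted_pairwise (@improves_trans _ _ _ M)) => so.
  have [ltpq|ltqp|eqpq] := ltngtP (index p pis) (index q pis).
  - by rewrite (sorted_ltn_index (@improves_trans _ _ _ M) so _ _ pp qq ltpq) orbT.
  - by rewrite (sorted_ltn_index (@improves_trans _ _ _ M) so _ _ qq pp ltqp) !orbT.
  - by rewrite -(nth_index p pp) eqpq nth_index // eqxx.
case/or3P: total => [/eqP pq|/and3P[_ _ /forallP/(_ y)]|/and3P[_ _ /forallP/(_ x)]].
- by rewrite pq qx in px.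
- by rewrite py (negPf qy).
- by rewrite qx (negPf px).
Qed.
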